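(* Let $N\ge2$, let $k\in\mathbb Z$ and let $L$ be an index matrix as described in the context. If $\phi\in C^\infty(\mathbb H_{1,N})$ is a Maaß-Jacobi form of weight $k$ and index $L$ which is H-harmonic (with respect to $L$), then $\phi$ is holomorphic in $z$.
   Context: Notation. $\mathbb H$ is the upper half plane, $\mathbb H_{1,N}=\mathbb H\times\mathbb C^N$ with coordinates $\tau=x+iy$, $z=u+iv$ (column vectors). $A[w]=w^TAw$. $\partial_z,\partial_{\bar z},\partial_u$ are the column vectors of $\partial_{z_j},\partial_{\bar z_j},\partial_{u_j}$. The index $L$ is a positive definite symmetric real $N\times N$ matrix with entries in $\frac12\mathbb Z$ and diagonal entries in $\mathbb Z$ (the Gram matrix of a positive definite integral even lattice); $\mathcal L=2\pi iL$. $\Delta_\kappa=4y^2\partial_\tau\partial_{\bar\tau}-2i\kappa y\,\partial_{\bar\tau}$. Jacobi group and slash action. $\Gamma^J_N=\mathrm{SL}_2(\mathbb Z)\ltimes \mathrm M_{N,2}(\mathbb Z)$, product $(M,X)(\check M,\check X)=(M\check M,X\check M+\check X)$. For $M=\begin{pmatrix}a&b\\c&d\end{pmatrix}$ and $X$ with columns $X_1,X_2$, the right action of $\Gamma^J_N$ on $C^\infty(\mathbb H_{1,N})$ is $$(\phi|_{k,L}[M,X])(\tau,z)=(c\tau+d)^{-k}\exp\Bigl\{2\pi i\Bigl(-\tfrac{c\,L[z+X_1\tau+X_2]}{c\tau+d}+2X_1^TLz+\tau L[X_1]\Bigr)\Bigr\}\,\phi\Bigl(\tfrac{a\tau+b}{c\tau+d},\tfrac{z+X_1\tau+X_2}{c\tau+d}\Bigr).$$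 Casimir operator (coefficient functions stand to the left of derivatives): $$\begin{aligned}\mathcal C^{k,L}=&-2\Delta_{k-N/2}+2y^2\bigl(\partial_{\bar\tau}\mathcal L^{-1}[\partial_z]+\partial_\tau\mathcal L^{-1}[\partial_{\bar z}]\bigr)-8y\,\partial_\tau v^T\partial_{\bar z}\\&-\tfrac12y^2\bigl(\mathcal L^{-1}[\partial_{\bar z}]\mathcal L^{-1}[\partial_z]-(\partial_{\bar z}^T\mathcal L^{-1}\partial_z)^2\bigr)+2y(v^T\partial_{\bar z})\partial_z^T\mathcal L^{-1}\partial_u\\&-\tfrac12(2k-N+1)iy\,\partial_{\bar z}^T\mathcal L^{-1}\partial_u+2v^T(v^T\partial_{\bar z})\partial_{\bar z}+(2k-N-1)iv^T\partial_{\bar z}.\end{aligned}$$ A Maaß-Jacobi form of weight $k$ and index $L$ is $\phi\in C^\infty(\mathbb H_{1,N})$ such that (1) $\phi|_{k,L}[A]=\phi$ for all $A\in\Gamma^J_N$; (2) $\phi$ is an eigenfunction of $\mathcal C^{k,L}$; (3) for some $a>0$, $\phi(\tau,z)=O\bigl(e^{ay}e^{2\pi L[v]/y}\bigr)$ as $y\to\infty$. H-harmonicity. Let $Y_-=-iy\,\partial_{\bar z}$ and $Y_+=i\partial_z+2iy^{-1}\mathcal Lv$ ($N$-vectors of operators). A function $\phi\in C^\infty(\mathbb H_{1,N})$ is H-harmonic if $(BY_+)^T(BY_-)\phi=0$ for all $B\in\mathrm{GL}_N(\mathbb R)$. *)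

(* Defs.v *)
From HB Require Import structures.
From mathcomp Require Import all_boot all_order all_algebra.
From mathcomp Require Import complex.
From mathcomp Require Import all_classical all_reals all_analysis.

Set Implicit Arguments.
Unset Strict Implicit.
Unset Printing Implicit Defensive.

Import Order.TTheory GRing.Theory Num.Theory.
Import numFieldNormedType.Exports.

Local Open Scope classical_set_scope.
Local Open Scope ring_scope.

(* The library only puts the norm topology on the alias R[i]^o. *)
HB.instance Definition _ (R : rcfType) := NormedModule.copy R[i] R[i]^o.

Section Functions.
Variables (R : realType) (N : nat).
Local Notation C := R[i].

Definition hpoint : Type := (C * 'cV[C]_N)%type.

(* Functions on H x C^N are total functions of (tau, z); their values outside
   H x C^N are irrelevant. *)
Definition jfun : Type := hpoint -> C.

Definition H1N : set hpoint := [set p | 0 < complex.Im p.1].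

Variant real_coord := CoordX | CoordY | CoordU of 'I_N | CoordV of 'I_N.

(* The real tangent direction at (tau, z) attached to a real coordinate, where
   tau = x + iy and z = u + iv. *)
Definition dir (d : real_coord) : C * 'cV[C]_N :=
  match d with
  | CoordX => (1, 0)
  | CoordY => ('i%C, 0)
  | CoordU j => (0, delta_mx j 0)
  | CoordV j => (0, 'i%C *: delta_mx j 0)
  end.

Definition along (d : real_coord) (f : jfun) (p : hpoint) (t : R) : C :=
  f ((p.1 + t%:C%C * (dir d).1), (p.2 + t%:C%C *: (dir d).2)).

Definition rpartial (d : real_coord) (f : jfun) : jfun := fun p =>
  (derive1 (fun t => complex.Re (along d f p t)) 0
   +i* derive1 (fun t => complex.Im (along d f p t)) 0)%C.

Definition rderivable (d : real_coord) (f : jfun) (p : hpoint) : Prop :=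
  derivable (fun t => complex.Re (along d f p t)) 0 1 /\
  derivable (fun t => complex.Im (along d f p t)) 0 1.

(* All iterated partial derivatives in the real coordinates exist and are
   continuous. *)
Definition smooth (f : jfun) : Prop :=
  forall (s : seq real_coord) (p : C * 'cV[C]_N), H1N p ->
    {for p, continuous (foldr rpartial f s : C * 'cV[C]_N -> C)} /\
    forall d, rderivable d (foldr rpartial f s) p.

Definition dtau (f : jfun) : jfun := fun p =>
  (rpartial CoordX f p - 'i%C * rpartial CoordY f p) / 2.
Definition dtaub (f : jfun) : jfun := fun p =>
  (rpartial CoordX f p + 'i%C * rpartial CoordY f p) / 2.
Definition dz (j : 'I_N) (f : jfun) : jfun := fun p =>
  (rpartial (CoordU j) f p - 'i%C * rpartial (CoordV j) f p) / 2.
Definition dzb (j : 'I_N) (f : jfun) : jfun := fun p =>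
  (rpartial (CoordU j) f p + 'i%C * rpartial (CoordV j) f p) / 2.
Definition du (j : 'I_N) (f : jfun) : jfun := rpartial (CoordU j) f.

(* D^T A E, for vectors of operators D and E and a constant matrix A. *)
Definition bilop (A : 'M[C]_N) (D E : 'I_N -> jfun -> jfun) (f : jfun) : jfun :=
  fun p => \sum_i \sum_j A i j * D i (E j f) p.

(* The vector B D, for a constant real matrix B. *)
Definition mxop (B : 'M[R]_N) (D : 'I_N -> jfun -> jfun) (i : 'I_N)
    (f : jfun) : jfun :=
  fun p => \sum_j (B i j)%:C%C * D j f p.

Definition holomorphic_in_z (f : jfun) : Prop :=
  forall tau : C, 0 < complex.Im tau ->
  forall z : 'cV[C]_N, differentiable (fun w : 'cV[C]_N => f (tau, w) : C) z.

End Functions.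

Arguments CoordX {N}.
Arguments CoordY {N}.

Section MaassJacobi.
Variables (R : realType) (N : nat).
Local Notation C := R[i].
Local Notation jfun := (jfun R N).

Definition cexp (w : C) : C :=
  (expR (complex.Re w))%:C%C * (cos (complex.Im w) +i* sin (complex.Im w))%C.

(* A[w] = w^T A w *)
Definition qform (K : pzRingType) (A : 'M[K]_N) (w : 'cV[K]_N) : K :=
  (w^T *m A *m w) 0 0.

(* 2 L is the Gram matrix of a positive definite even lattice. *)
Definition is_index (L : 'M[R]_N) : Prop :=
  [/\ L^T = L,
      forall w : 'cV[R]_N, w != 0 -> 0 < qform L w,
      forall i j, 2 * L i j \is a Num.int
    & forall i, L i i \is a Num.int].

Definition mxC (L : 'M[R]_N) : 'M[C]_N := map_mx (fun x : R => x%:C%C) L.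

Definition calL (L : 'M[R]_N) : 'M[C]_N := (2 * (pi : R)%:C%C * 'i%C) *: mxC L.

Definition jacobi_group : set ('M[int]_2 * 'M[int]_(N, 2)) :=
  [set A | \det A.1 = 1].

Definition slash (k : int) (L : 'M[R]_N) (A : 'M[int]_2 * 'M[int]_(N, 2))
    (f : jfun) : jfun := fun p =>
  let: (tau, z) := p in
  let a : C := (A.1 0 0)%:~R in let b : C := (A.1 0 1)%:~R in
  let c : C := (A.1 1 0)%:~R in let d : C := (A.1 1 1)%:~R in
  let X1 : 'cV[C]_N := \col_i (A.2 i 0)%:~R in
  let X2 : 'cV[C]_N := \col_i (A.2 i 1)%:~R in
  let w := z + tau *: X1 + X2 in
  let J := c * tau + d in
  J ^ (- k) *
  cexp (2 * (pi : R)%:C%C * 'i%C *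
    (- (c * qform (mxC L) w / J) + 2 * (X1^T *m mxC L *m z) 0 0
     + tau * qform (mxC L) X1)) *
  f ((a * tau + b) / J, J^-1 *: w).

Definition laplace (kappa : C) (f : jfun) : jfun := fun p =>
  let y : C := (complex.Im p.1)%:C%C in
  4 * y ^+ 2 * dtau (dtaub f) p - 2 * 'i%C * kappa * y * dtaub f p.

(* All coefficient functions stand to the left of the derivatives, so for
   instance v^T (v^T d_zbar) d_zbar is sum_(i,j) v_i v_j d_zbar_j d_zbar_i. *)
Definition casimir (k : int) (L : 'M[R]_N) (f : jfun) : jfun := fun p =>
  let y : C := (complex.Im p.1)%:C%C in
  let v (j : 'I_N) : C := (complex.Im (p.2 j 0))%:C%C in
  let kC : C := k%:~R in
  let nC : C := N%:R in
  let Li := invmx (calL L) in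
  - 2 * laplace (kC - nC / 2) f p
  + 2 * y ^+ 2 * (dtaub (bilop Li (@dz R N) (@dz R N) f) p
                  + dtau (bilop Li (@dzb R N) (@dzb R N) f) p)
  - 8 * y * (\sum_j v j * dtau (dzb j f) p)
  - 2^-1 * y ^+ 2 *
      (bilop Li (@dzb R N) (@dzb R N) (bilop Li (@dz R N) (@dz R N) f) p
       - bilop Li (@dzb R N) (@dz R N) (bilop Li (@dzb R N) (@dz R N) f) p)
  + 2 * y * (\sum_j v j * dzb j (bilop Li (@dz R N) (@du R N) f) p)
  - 2^-1 * (2 * kC - nC + 1) * 'i%C * y * bilop Li (@dzb R N) (@du R N) f p
  + 2 * (\sum_i \sum_j v i * v j * dzb j (dzb i f) p)
  + (2 * kC - nC - 1) * 'i%C * (\sum_j v j * dzb j f p).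

(* The bound is uniform in x, u and v. *)
Definition moderate_growth (L : 'M[R]_N) (f : jfun) : Prop :=
  exists2 a : R, 0 < a & exists K y0 : R, forall p : hpoint R N, H1N p ->
    let y := complex.Im p.1 in
    let v : 'cV[R]_N := \col_j complex.Im (p.2 j 0) in
    y0 <= y ->
    `|f p| <= (K * (expR (a * y) * expR (2 * pi * qform L v / y)))%:C%C.

(* The zero function is a Maass-Jacobi form. *)
Definition maass_jacobi (k : int) (L : 'M[R]_N) (f : jfun) : Prop :=
  [/\ smooth f,
      forall A, jacobi_group A -> forall p, H1N p -> slash k L A f p = f p,
      exists lambda : C, forall p, H1N p -> casimir k L f p = lambda * f p
    & moderate_growth L f].

Definition Yminus (j : 'I_N) (f : jfun) : jfun := fun p =>
  - 'i%C * (complex.Im p.1)%:C%C * dzb j f p.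

Definition Yplus (L : 'M[R]_N) (j : 'I_N) (f : jfun) : jfun := fun p =>
  let v : 'cV[C]_N := \col_l (complex.Im (p.2 l 0))%:C%C in
  'i%C * dz j f p
  + 2 * 'i%C * ((complex.Im p.1)%:C%C)^-1 * (calL L *m v) j 0 * f p.

Definition H_harmonic (L : 'M[R]_N) (f : jfun) : Prop :=
  forall B : 'M[R]_N, B \in unitmx -> forall p, H1N p ->
    \sum_i mxop B (Yplus L) i (mxop B Yminus i f) p = 0.

End MaassJacobi.

(* Main.v *)
From HB Require Import structures.
From mathcomp Require Import all_boot all_order all_algebra.
From mathcomp Require Import complex.
From mathcomp Require Import ring lra.
From mathcomp Require Import all_classical all_reals all_analysis.
Require Import Defs.

(** Fix tau in the upper half plane and put y = Im tau.  Testing harmonicity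
    against diagonal matrices B separates the directions: Y_+,j Y_-,j phi = 0
    for every single j ([harmonic_component]).  Restrict alpha = d_zbar_j phi
    to a complex line zeta = s + i t in the direction of z_j.  The equation
    Y_+,j alpha = 0 becomes (d_s - i d_t) alpha + i psi'(t) alpha = 0, where
    psi is, up to a constant, 4 pi L[v] / y on that line, a quadratic
    polynomial in t with psi'' = 8 pi L_jj / y > 0.  In other words
    alpha e^(-psi) is antiholomorphic, so the nonnegative function
      h = |alpha|^2 e^(-psi) = |alpha e^(-psi)|^2 e^psi
    satisfies Laplacian h >= psi'' h, like every squared modulus of an
    antiholomorphic function weighted by e^psi.

    On the other hand h is doubly periodic.  The elements (1, X) of the Jacobi
    group translate z by e_j and by tau e_j; the automorphy factor is
    holomorphic in z, so it passes through d_zbar_j ([dbar_factor]) and its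
    squared modulus is exactly compensated by the weight e^(-psi).  Hence h is
    a continuous function on a torus and has a maximum, where its Laplacian is
    at most 0.  Thus psi'' h <= 0 there, h = 0 everywhere, and d_zbar_j phi = 0
    ([torus_twisted_vanish], [dbar_slice_eq0]).

    It remains to pass from the vanishing of all d_zbar_j phi to complex
    differentiability.  The partial derivatives of phi are continuous, and the
    mean value theorem along the coordinate axes shows that
    w |-> sum_j w_j d_z_j phi is the differential ([differentiable_of_CR]). *)

Set Implicit Arguments.
Unset Strict Implicit.
Unset Printing Implicit Defensive.

Import Order.TTheory GRing.Theory Num.Theory.
Import numFieldNormedType.Exports.

Local Open Scope classical_set_scope.
Local Open Scope ring_scope.

(** * Calculus in one and two real variables *)

Section Real.
Variable R : realType.

Lemma MVT_lt (f df : R -> R) (a b : R) : a < b ->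
  (forall x : R, is_derive x 1 f (df x)) ->
  exists2 c, a < c < b & f b - f a = df c * (b - a).
Proof.
move=> ab fd; have fc : {within `[a, b], continuous f}.
  by apply: derivable_within_continuous => x _; case: (fd x).
have [c] := MVT ab (fun x _ => fd x) fc.
by rewrite in_itv/= => ? ?; exists c.
Qed.

(** The bound on the distance covers both orders of the end points. *)
Lemma MVT_dist (f df : R -> R) (a b : R) :
  (forall x : R, is_derive x 1 f (df x)) ->
  exists2 c, `|c - a| <= `|b - a| & f b - f a = df c * (b - a).
Proof.
move=> fd; have [ab|ba|->] := ltgtP a b.
- have [c /andP[ac cb] e] := MVT_lt ab fd; exists c => //.
  by rewrite !ger0_norm; lra.
- have [c /andP[ac cb] e] := MVT_lt ba fd; exists c; last lra.
  by rewrite !ler0_norm; lra.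
- by exists b => //; rewrite !subrr mulr0.
Qed.

Lemma derive_max0 (f : R -> R) (d x : R) : is_derive x 1 f d ->
  (forall y : R, derivable f y 1) -> (forall y, f y <= f x) -> d = 0.
Proof.
move=> fd fD fm.
have x1 : x - 1 <= x + 1 by lra.
have xx : x \in `]x - 1, x + 1[ by rewrite in_itv/=; apply/andP; split; lra.
have [_ <-] := derive1_at_max x1 (fun t _ => fD t) xx (fun t _ => fm t).
by case: fd.
Qed.

(** A positive second derivative at the critical point x would make f'
    positive just to the right of x, and f would increase there. *)
Lemma second_derive_max (f df : R -> R) (d x : R) :
  (forall y : R, is_derive y 1 f (df y)) ->
  is_derive x 1 df d -> (forall y, f y <= f x) -> d <= 0.
Proof.
move=> fd fdd fm; rewrite leNgt; apply/negP => d0.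
have dfx : df x = 0 by apply: (derive_max0 (fd x)) => // y; case: (fd y).
have [dc de] := fdd.
have : \forall h \near 0^', 0 < h^-1 *: ((df \o shift x) (h *: 1) - df x).
  have : (fun h => h^-1 *: ((df \o shift x) (h *: 1) - df x)) @ 0^' --> d.
    by rewrite -de; exact: dc.
  by move=> /cvgr_gt; apply.
rewrite near_withinE => /nbhs_ballP[e /= e0 be].
have xe : x < x + e by rewrite ltrDl.
have [c /andP[c0 ce]] := MVT_lt xe fd.
have cx : 0 < c - x by lra.
have := be (c - x).
rewrite -ball_normE /= sub0r normrN gtr0_norm // dfx subr0.
rewrite -[X in df (X + x)]/((c - x) * 1) mulr1 subrK.
rewrite -[_ *: _]/(_ * _) pmulr_rgt0 ?invr_gt0// => H.
have {}H : 0 < df c by apply: H; [lra|rewrite gt_eqF].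
move=> E; have := fm (x + e).
have : 0 < df c * (x + e - x) by rewrite mulr_gt0//; lra.
lra.
Qed.

(** Schwarz: by two applications of the mean value theorem, the increment of
    f over a small square is the area times a value of each of the two mixed
    derivatives near the corner. *)
Lemma mixed_partials (f fs ft fst fts : R -> R -> R) :
  (forall s t : R, is_derive s 1 (f ^~ t) (fs s t)) ->
  (forall s t : R, is_derive t 1 (f s) (ft s t)) ->
  (forall s t : R, is_derive t 1 (fs s) (fst s t)) ->
  (forall s t : R, is_derive s 1 (ft ^~ t) (fts s t)) ->
  forall s t : R,
  {for (s, t), continuous (fun p : R * R => fst p.1 p.2)} ->
  {for (s, t), continuous (fun p : R * R => fts p.1 p.2)} ->
  fst s t = fts s t.
Proof.
move=> Hs Ht Hst Hts s t c1 c2; apply/eqP; rewrite -subr_eq0 -normr_eq0.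
apply/eqP/le_anti; rewrite normr_ge0 andbT; apply/ler_addgt0Pr => e e0; rewrite add0r.
have e20 : 0 < e / 2 by rewrite divr_gt0.
have /cvgr_distC_lt/(_ _ e20)/nbhs_ballP[d1 /= d10 b1] := c1.
have /cvgr_distC_lt/(_ _ e20)/nbhs_ballP[d2 /= d20 b2] := c2.
have [d [d0 dd1 dd2]] : exists d, [/\ 0 < d, d < d1 & d < d2].
  exists (Num.min d1 d2 / 2); have : 0 < Num.min d1 d2 by rewrite lt_min d10.
  by case: (leP d1 d2) => *; split; lra.
have inball (a b dd : R) : s < a < s + d -> t < b < t + d -> d < dd ->
    ball (s, t) dd (a, b).
  move=> /andP[? ?] /andP[? ?] ?.
  by split; rewrite -ball_normE /ball_ /= distrC gtr0_norm; lra.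
have sd : s < s + d by lra.
have td : t < t + d by lra.
(* The increment of f over the square, computed in both orders. *)
have [x xd Ex] := MVT_lt sd (fun u =>
  is_deriveB (Hs u (t + d)) (Hs u t) :
    is_derive u 1 (fun u => f u (t + d) - f u t) (fs u (t + d) - fs u t)).
have [y yd Ey] := MVT_lt td (Hst x).
have [x' xd' Ex'] := MVT_lt td (fun u =>
  is_deriveB (Ht (s + d) u) (Ht s u) :
    is_derive u 1 (fun u => f (s + d) u - f s u) (ft (s + d) u - ft s u)).
have [y' yd' Ey'] := MVT_lt sd (fun u => Hts u x').
have E : fst x y = fts y' x'.
  have dd : d * d != 0 by rewrite mulf_neq0 // gt_eqF.
  apply: (mulIf dd).
  by move: Ex Ex'; rewrite Ey Ey' => H1 H2; lra.
have := b1 (x, y) (inball _ _ _ xd yd dd1).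
have := b2 (y', x') (inball _ _ _ yd' xd' dd2).
rewrite /= E => B1 B2.
rewrite -[e](@divfK _ 2) // mulr_natr mulr2n.
by rewrite (le_trans (ler_distD (fts y' x') _ _))// lerD // ltW // distrC.
Qed.

Lemma is_derive_unique (f : R -> R) (u d d' : R) :
  is_derive u 1 f d -> is_derive u 1 f d' -> d = d'.
Proof. by move=> [_ <-] [_ <-]. Qed.

Lemma is_derive_mul (f g : R -> R) (t df dg : R) :
  is_derive t 1 f df -> is_derive t 1 g dg ->
  is_derive t 1 (fun u => f u * g u) (df * g t + f t * dg).
Proof.
move=> Hf Hg; have H := is_deriveM Hf Hg.
by apply: (is_derive_eq H); rewrite addrC mulrC [X in _ + X]mulrC.
Qed.

Lemma is_derive_add (f g : R -> R) (t df dg : R) :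
  is_derive t 1 f df -> is_derive t 1 g dg ->
  is_derive t 1 (fun u => f u + g u) (df + dg).
Proof. by move=> Hf Hg; exact: (is_deriveD Hf Hg). Qed.

Lemma is_derive_sub (f g : R -> R) (t df dg : R) :
  is_derive t 1 f df -> is_derive t 1 g dg ->
  is_derive t 1 (fun u => f u - g u) (df - dg).
Proof. by move=> Hf Hg; exact: (is_deriveB Hf Hg). Qed.

Lemma is_derive_inner (f f' g g' : R -> R) (t df df' dg dg' : R) :
  is_derive t 1 f df -> is_derive t 1 f' df' -> is_derive t 1 g dg ->
  is_derive t 1 g' dg' ->
  is_derive t 1 (fun u => f u * f' u + g u * g' u)
    (df * f' t + f t * df' + (dg * g' t + g t * dg')).
Proof. by move=> *; apply: is_derive_add; apply: is_derive_mul. Qed.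

Lemma is_derive_weight (psi : R -> R) (t d : R) : is_derive t 1 psi d ->
  is_derive t 1 (fun u => expR (- psi u)) (- d * expR (- psi t)).
Proof.
move=> H; rewrite mulrC.
exact: (@is_derive1_comp R expR (fun u => - psi u) t _ _ _ (is_deriveN H)).
Qed.

Lemma derive1_translate (g : R -> R) (s : R) :
  derive1 (fun h => g (s + h)) 0 = 'D_1 g s.
Proof.
rewrite /derive1 /derive.
set F1 := (X in lim (X @ _)); set F2 := (X in _ = lim (X @ _)).
suff -> : F1 = F2 by [].
by apply/funext => h; rewrite /F1 /F2 /= addr0 addr0 [h *: 1]mulr1 [s + h]addrC.
Qed.

Lemma is_derive_translate (g : R -> R) (s : R) :
  derivable (fun h => g (s + h)) 0 1 ->
  is_derive s 1 g (derive1 (fun h => g (s + h)) 0).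
Proof.
rewrite derive1_translate => d; apply: DeriveDef; last by [].
apply/derivable1P; suff <- : (fun h => g (s + h)) = (fun h : R => g (h *: 1 + s)) by [].
by apply/funext => h; rewrite addrC [h *: 1]mulr1.
Qed.

Lemma derive1_translateE (g : R -> R) (s d : R) : is_derive s 1 g d ->
  derive1 (fun h => g (s + h)) 0 = d.
Proof. by rewrite derive1_translate => -[]. Qed.

End Real.

(** * A maximum principle on the torus *)

Section Torus.
Variable R : realType.

(** Derivatives are carried as explicit functions, because those of a slice
    of phi are again slices, of iterated partial derivatives of phi. *)
Definition partials (f fs ft : R -> R -> R) := forall s t : R,
  is_derive s 1 (f ^~ t) (fs s t) /\ is_derive t 1 (f s) (ft s t).

Definition continuous2 (f : R -> R -> R) :=
  continuous (fun p : R * R => f p.1 p.2).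

(** The square [0, 1] x [0, y] contains a representative of every point
    modulo the lattice spanned by (1, 0) and (x, y). *)
Lemma periodic_max (h : R -> R -> R) (x y : R) : 0 < y -> continuous2 h ->
  (forall s t, h (s + 1) t = h s t) -> (forall s t, h (s + x) (t + y) = h s t) ->
  exists s0 t0, forall s t, h s t <= h s0 t0.
Proof.
move=> y0 ch p1 p2.
have pn s t (n : nat) : h (s + n%:R) t = h s t.
  by elim: n s => [|n IH] s; rewrite ?addr0 // -natr1 addrA p1.
have pz s t (n : int) : h (s + n%:~R) t = h s t.
  case: n => n; first exact: pn.
  by have := pn (s - n.+1%:R) t n.+1; rewrite subrK NegzE mulrNz => ->.
have qn s t (n : nat) : h (s + x * n%:R) (t + y * n%:R) = h s t.
  elim: n s t => [|n IH] s t; first by rewrite !mulr0 !addr0.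
  by rewrite -natr1 !mulrDr !mulr1 !addrA p2.
have qz s t (n : int) : h (s + x * n%:~R) (t + y * n%:~R) = h s t.
  case: n => n; first exact: qn.
  have := qn (s - x * n.+1%:R) (t - y * n.+1%:R) n.+1.
  by rewrite !subrK NegzE mulrNz !mulrN => ->.
have cK : compact (`[0, 1]%classic `*` `[0, y]%classic : set (R * R)).
  by apply: compact_setX; exact: segment_compact.
have [|[s0 t0] _ mx] := compact_EVT_max (f := fun p : R * R => h p.1 p.2) _ cK
   (continuous_subspaceT ch).
  exists (0, 0); split; rewrite /= in_itv /= lexx /=; first exact: ler01.
  exact: ltW.
exists s0, t0 => s t.
pose n := Num.floor (t / y); pose m := Num.floor (s - x * n%:~R).
rewrite -(subrK (x * n%:~R) s) -(subrK (y * n%:~R) t) qz.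
rewrite -(subrK m%:~R (s - _)) pz.
have := mx (s - x * n%:~R - m%:~R, t - y * n%:~R); apply; apply/mem_set.
have /andP[n1 n2] := floor_itv (t / y).
have /andP[m1 m2] := floor_itv (s - x * n%:~R).
rewrite -/n -/m in n1 n2 m1 m2.
split; rewrite /= in_itv /=; apply/andP; split.
- by rewrite subr_ge0.
- by rewrite lerBlDl -intrD1 ltW // intrD1.
- by rewrite subr_ge0 mulrC -ler_pdivlMr.
- by rewrite lerBlDl; move: n2; rewrite intrD ltr_pdivrMr //; lra.
Qed.

(** With alpha = a + i b, the two differential equations say that
    (d_s - i d_t) alpha + i psi' alpha = 0.  They imply
      e^psi (h_ss + h_tt) = c |alpha|^2 + (a_t + b_s)^2 + (b_t - a_s)^2,
    which contradicts h_ss + h_tt <= 0 at a maximum of h unless alpha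
    vanishes there, and then h is at most 0 everywhere. *)
Lemma torus_twisted_vanish (a b as_ bs at_ bt ass ast ats att bss bst bts btt : R -> R -> R)
    (psi dpsi : R -> R) (c x y : R) :
  0 < y -> 0 < c ->
  (forall t : R, is_derive t 1 psi (dpsi t)) -> (forall t : R, is_derive t 1 dpsi c) ->
  continuous2 a -> continuous2 b ->
  partials a as_ at_ -> partials as_ ass ast -> partials at_ ats att ->
  continuous2 ast -> continuous2 ats ->
  partials b bs bt -> partials bs bss bst -> partials bt bts btt ->
  continuous2 bst -> continuous2 bts ->
  (forall s t, as_ s t = dpsi t * b s t - bt s t) ->
  (forall s t, bs s t = at_ s t - dpsi t * a s t) ->
  let h s t := (a s t ^+ 2 + b s t ^+ 2) * expR (- psi t) in
  (forall s t, h (s + 1) t = h s t) -> (forall s t, h (s + x) (t + y) = h s t) ->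
  forall s t, a s t = 0 /\ b s t = 0.
Proof.
move=> y0 c0 dp ddp ca cb pa pas pat cast cats pb pbs pbt cbst cbts e1 e2 h h1 h2.
pose N s t := a s t ^+ 2 + b s t ^+ 2.
have cw : continuous (fun t => expR (- psi t)).
  move=> t; apply/differentiable_continuous/derivable1_diffP.
  by case: (is_derive_weight (dp t)).
have ch : continuous2 h.
  move=> [s t]; rewrite /continuous_at /h /=; apply: cvgM.
    rewrite /=; have A := ca (s, t); have B := cb (s, t).
    by apply: cvgD; [exact: (cvgM A A)|exact: (cvgM B B)].
  by apply: (cvg_comp snd (fun t => expR (- psi t)) _ (cw t)); exact: cvg_snd.
have [s0 [t0 mx]] := periodic_max y0 ch h1 h2.
have Sa : ast s0 t0 = ats s0 t0.
  by apply: (mixed_partials (f := a) (fs := as_) (ft := at_));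
    [move=> *; apply (pa _ _).1|move=> *; apply (pa _ _).2
    |move=> *; apply (pas _ _).2|move=> *; apply (pat _ _).1|exact: cast|exact: cats].
have Sb : bst s0 t0 = bts s0 t0.
  by apply: (mixed_partials (f := b) (fs := bs) (ft := bt));
    [move=> *; apply (pb _ _).1|move=> *; apply (pb _ _).2
    |move=> *; apply (pbs _ _).2|move=> *; apply (pbt _ _).1|exact: cbst|exact: cbts].
pose w t := expR (- psi t).
have w0 t : 0 < w t by exact: expR_gt0.
(* On the horizontal line through the maximum the weight is constant. *)
have Nm s : N s t0 <= N s0 t0 by rewrite -(ler_pM2r (w0 t0)); exact: mx.
have E1 := second_derive_max
  (fun s => is_derive_inner (pa s t0).1 (pa s t0).1 (pb s t0).1 (pb s t0).1)
  (is_derive_add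
    (is_derive_inner (pas s0 t0).1 (pa s0 t0).1 (pa s0 t0).1 (pas s0 t0).1)
    (is_derive_inner (pbs s0 t0).1 (pb s0 t0).1 (pb s0 t0).1 (pbs s0 t0).1))
  Nm.
have D1 t := is_derive_mul
  (is_derive_inner (pa s0 t).2 (pa s0 t).2 (pb s0 t).2 (pb s0 t).2)
  (is_derive_weight (dp t)).
have D2 := is_derive_add
  (is_derive_mul (is_derive_add
    (is_derive_inner (pat s0 t0).2 (pa s0 t0).2 (pa s0 t0).2 (pat s0 t0).2)
    (is_derive_inner (pbt s0 t0).2 (pb s0 t0).2 (pb s0 t0).2 (pbt s0 t0).2))
   (is_derive_weight (dp t0)))
  (is_derive_mul
    (is_derive_inner (pa s0 t0).2 (pa s0 t0).2 (pb s0 t0).2 (pb s0 t0).2)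
   (is_derive_mul
     (is_deriveN (ddp t0) : is_derive t0 1 (fun t => - dpsi t) (- c))
     (is_derive_weight (dp t0)))).
have E2 := second_derive_max D1 D2 (mx s0).
(* The second derivatives that the equations of the hypothesis determine. *)
have F1 : ass s0 t0 = dpsi t0 * bs s0 t0 - bts s0 t0.
  apply: (is_derive_unique (pas s0 t0).1).
  have -> : as_ ^~ t0 = (fun s => dpsi t0 * b s t0 - bt s t0).
    by apply/funext => s; exact: e1.
  apply: is_derive_sub; last exact: (pbt s0 t0).1.
  exact: (is_deriveZ (dpsi t0) (pb s0 t0).1).
have F2 : bss s0 t0 = ats s0 t0 - dpsi t0 * as_ s0 t0.
  apply: (is_derive_unique (pbs s0 t0).1).
  have -> : bs ^~ t0 = (fun s => at_ s t0 - dpsi t0 * a s t0).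
    by apply/funext => s; exact: e2.
  apply: is_derive_sub; first exact: (pat s0 t0).1.
  exact: (is_deriveZ (dpsi t0) (pa s0 t0).1).
have F3 : ast s0 t0 = c * b s0 t0 + dpsi t0 * bt s0 t0 - btt s0 t0.
  apply: (is_derive_unique (pas s0 t0).2).
  have -> : as_ s0 = (fun t => dpsi t * b s0 t - bt s0 t).
    by apply/funext => t; exact: e1.
  apply: is_derive_sub; last exact: (pbt s0 t0).2.
  exact: is_derive_mul (ddp t0) (pb s0 t0).2.
have F4 : bst s0 t0 = att s0 t0 - (c * a s0 t0 + dpsi t0 * at_ s0 t0).
  apply: (is_derive_unique (pbs s0 t0).2).
  have -> : bs s0 = (fun t => at_ s0 t - dpsi t * a s0 t).
    by apply/funext => t; exact: e2.
  apply: is_derive_sub; first exact: (pat s0 t0).2.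
  exact: is_derive_mul (ddp t0) (pa s0 t0).2.
have N0 : N s0 t0 <= 0.
  have := w0 t0; rewrite /w in E1 E2 *; rewrite /N.
  have G1 := e1 s0 t0; have G2 := e2 s0 t0.
  move: E1 E2 F1 F2 F3 F4 G1 G2; rewrite Sa Sb.
  move: (expR _) (a _ _) (b _ _) (as_ _ _) (bs _ _) (at_ _ _) (bt _ _) (ass _ _)
    (ats _ _) (att _ _) (bss _ _) (bts _ _) (btt _ _) (dpsi _).
  move=> W A B As Bs At Bt Ass Ats Att Bss Bts Btt d E1 E2 F1 F2 F3 F4 G1 G2 W0.
  (* X is e^psi h_tt at the maximum. *)
  pose X := 2 * (At ^+ 2 + Bt ^+ 2 + A * Att + B * Btt)
    - 4 * d * (A * At + B * Bt) + (d ^+ 2 - c) * (A ^+ 2 + B ^+ 2).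
  have X0 : X <= 0.
    rewrite -(pmulr_lle0 _ W0); apply: le_trans E2.
    by rewrite le_eqVlt /X; apply/orP; left; apply/eqP; ring.
  rewrite -(pmulr_rle0 _ c0).
  suff : c * (A ^+ 2 + B ^+ 2) + ((At + Bs) ^+ 2 + (Bt - As) ^+ 2) <= 0.
    by have := sqr_ge0 (At + Bs); have := sqr_ge0 (Bt - As); lra.
  apply: le_trans (_ : X + 2 * (As * As + A * Ass + (Bs * Bs + B * Bss)) <= 0).
    rewrite le_eqVlt; apply/orP; left; apply/eqP.
    by rewrite /X F1 F2 F3; rewrite F4 G1 G2; ring.
  by move: E1 X0; lra.
move=> s t.
have : h s t <= 0.
  by apply: le_trans (mx s t) _; rewrite pmulr_lle0 ?w0.
rewrite pmulr_lle0 ?w0 // => H.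
have A0 := sqr_ge0 (a s t); have B0 := sqr_ge0 (b s t).
by split; apply/eqP; rewrite -sqrf_eq0; apply/eqP; lra.
Qed.

End Torus.

(** * Quasi-periodicity and the Cauchy-Riemann operator *)

Section Factor.
Variable R : realType.

Lemma partials_translate (f fs ft : R -> R -> R) (x y : R) : partials f fs ft ->
  partials (fun s t => f (s + x) (t + y)) (fun s t => fs (s + x) (t + y))
           (fun s t => ft (s + x) (t + y)).
Proof.
move=> pf s t; have [d1 d2] := pf (s + x) (t + y); split.
  have := is_derive1_comp (g := shift x) (x := s) d1 (is_derive_shift _ _ _).
  by rewrite mulr1.
have := is_derive1_comp (g := shift y) (x := t) d2 (is_derive_shift _ _ _).
by rewrite mulr1.
Qed.

(** The Leibniz rule for d_zbar F with F = E G, where E = E1 + i E2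
    satisfies the Cauchy-Riemann equations: no derivative of E survives. *)
Lemma dbar_factor (F1 F1s F1t F2 F2s F2t G1 G1s G1t G2 G2s G2t E1 E1s E1t E2 : R -> R -> R) :
  partials F1 F1s F1t -> partials F2 F2s F2t ->
  partials G1 G1s G1t -> partials G2 G2s G2t ->
  partials E1 E1s E1t -> partials E2 (fun s t => - E1t s t) E1s ->
  (forall s t, F1 s t = E1 s t * G1 s t - E2 s t * G2 s t) ->
  (forall s t, F2 s t = E1 s t * G2 s t + E2 s t * G1 s t) ->
  forall s t,
  F1s s t - F2t s t = E1 s t * (G1s s t - G2t s t) - E2 s t * (G2s s t + G1t s t) /\
  F2s s t + F1t s t = E1 s t * (G2s s t + G1t s t) + E2 s t * (G1s s t - G2t s t).
Proof.
move=> pF1 pF2 pG1 pG2 pE1 pE2 e1 e2 s t.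
have f1 : F1 = fun s t => E1 s t * G1 s t - E2 s t * G2 s t.
  by apply/funext => ?; apply/funext => ?; exact: e1.
have f2 : F2 = fun s t => E1 s t * G2 s t + E2 s t * G1 s t.
  by apply/funext => ?; apply/funext => ?; exact: e2.
have [G1S G1T] := pG1 s t; have [G2S G2T] := pG2 s t.
have [E1S E1T] := pE1 s t; have [E2S E2T] := pE2 s t.
rewrite {}f1 in pF1; rewrite {}f2 in pF2.
have -> := is_derive_unique (pF1 s t).1 (is_derive_sub (is_derive_mul E1S G1S) (is_derive_mul E2S G2S)).
have -> := is_derive_unique (pF1 s t).2 (is_derive_sub (is_derive_mul E1T G1T) (is_derive_mul E2T G2T)).
have -> := is_derive_unique (pF2 s t).1 (is_derive_add (is_derive_mul E1S G2S) (is_derive_mul E2S G1S)).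
have -> := is_derive_unique (pF2 s t).2 (is_derive_add (is_derive_mul E1T G2T) (is_derive_mul E2T G1T)).
by split; ring.
Qed.

(** The components of exp (i (k (s + i t) + n + i m)), a function satisfying
    the Cauchy-Riemann equations, in the form expected by [dbar_factor]. *)
Lemma exp_partials (k m n : R) :
  let E1 s t := expR (- (k * t + m)) * cos (k * s + n) in
  let E2 s t := expR (- (k * t + m)) * sin (k * s + n) in
  partials E1 (fun s t => - k * E2 s t) (fun s t => - k * E1 s t) /\
  partials E2 (fun s t => - (- k * E1 s t)) (fun s t => - k * E2 s t).
Proof.
move=> E1 E2.
have aff (l u : R) : is_derive u 1 (fun u => k * u + l) k.
  have := is_derive_add (is_deriveZ k (is_derive_id u 1)) (is_derive_cst l u 1).
  by rewrite addr0 [k *: 1]mulr1.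
have dE t := is_derive_weight (aff m t).
have dcos s := @is_derive1_comp R cos (fun s => k * s + n) s _ _ (is_derive_cos _) (aff n s).
have dsin s := @is_derive1_comp R sin (fun s => k * s + n) s _ _ (is_derive_sin _) (aff n s).
pose e t := expR (- (k * t + m)).
split=> s t; split; rewrite /E1 /E2.
- apply: is_derive_eq (is_derive_mul (is_derive_cst (e t) s 1) (dcos s)) _.
  by rewrite /cst /e; ring.
- apply: is_derive_eq (is_derive_mul (dE t) (is_derive_cst (cos (k * s + n)) t 1)) _.
  by rewrite /cst; ring.
- apply: is_derive_eq (is_derive_mul (is_derive_cst (e t) s 1) (dsin s)) _.
  by rewrite /cst /e; ring.
- apply: is_derive_eq (is_derive_mul (dE t) (is_derive_cst (sin (k * s + n)) t 1)) _.
  by rewrite /cst; ring.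
Qed.

End Factor.

(** * Restriction to complex lines *)

Section Slice.
Variables (R : realType) (N : nat).
Local Notation C := R[i].
Local Notation Re := (@complex.Re R).
Local Notation Im := (@complex.Im R).

Lemma Re_mul (x y : C) : Re (x * y) = Re x * Re y - Im x * Im y.
Proof. by case: x y => ? ? []. Qed.

Lemma Im_mul (x y : C) : Im (x * y) = Re x * Im y + Im x * Re y.
Proof. by case: x y => ? ? []. Qed.

Lemma Im_add (x y : C) : Im (x + y) = Im x + Im y.
Proof. by case: x y => ? ? []. Qed.

Lemma normc_Re_le (x : C) : `|Re x|%:C%C <= `|x|.
Proof. exact: normc_ge_Re. Qed.

Lemma normc_Im_le (x : C) : `|Im x|%:C%C <= `|x|.
Proof.
have := normc_ge_Re (x * 'i%C); rewrite ReiNIm normrN normrM.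
by rewrite complexiE normCi mulr1.
Qed.

Lemma normc_le_ReIm (x : C) : `|x| <= (`|Re x| + `|Im x|)%:C%C.
Proof.
rewrite {1}[x]complexE rmorphD /= (le_trans (ler_normD _ _)) // normrM.
by rewrite complexiE normCi mul1r !normc_def /= !expr0n /= !addr0 !sqrtr_sqr.
Qed.

Lemma Re_continuous : continuous Re.
Proof.
move=> x; apply/(@cvgrPdist_lt _ _ _ (nbhs x) _) => e e0.
have e0' : 0 < e%:C%C :> C by rewrite ltcR.
apply/nbhs_ballP; exists e%:C%C => //= y; rewrite -ball_normE /= => xy.
rewrite -ltcR; have -> : Re x - Re y = Re (x - y) by case: x y {xy} => ? ? [].
exact: le_lt_trans (normc_Re_le _) xy.
Qed.

Lemma Im_continuous : continuous Im.
Proof.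
move=> x; apply/(@cvgrPdist_lt _ _ _ (nbhs x) _) => e e0.
have e0' : 0 < e%:C%C :> C by rewrite ltcR.
apply/nbhs_ballP; exists e%:C%C => //= y; rewrite -ball_normE /= => xy.
rewrite -ltcR; have -> : Im x - Im y = Im (x - y) by case: x y {xy} => ? ? [].
exact: le_lt_trans (normc_Im_le _) xy.
Qed.

Lemma Complex_continuous : continuous (fun p : R * R => (p.1 +i* p.2)%C : C).
Proof.
move=> [s t]; apply/(@cvgrPdist_lt _ _ _ (nbhs (s, t)) _) => e; rewrite ltcE /= => /andP[/eqP e2 e1].
have e0' : 0 < Re e / 2 by rewrite divr_gt0.
apply/nbhs_ballP; exists (Re e / 2) => //= -[a b] [].
rewrite -!ball_normE /= => sa tb.
by apply: le_lt_trans (normc_le_ReIm _) _; rewrite ltcE /= -e2 eqxx /= [Re e]splitr ltrD.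
Qed.

(** The complex line through (tau, z) in the direction of z_j, in real
    coordinates; every slice stays inside H x C^N as tau does not move. *)
Definition slice (tau : C) (z : 'cV[C]_N) (j : 'I_N) (s t : R) : hpoint R N :=
  (tau, z + (s +i* t)%C *: delta_mx j 0).

Lemma slice_continuous tau z j :
  continuous (fun p : R * R => slice tau z j p.1 p.2 : C * 'cV[C]_N).
Proof.
move=> p; pose e : 'cV[C]_N := delta_mx j 0.
have Hc : (q.1 +i* q.2)%C *: e @[q --> p] --> (p.1 +i* p.2)%C *: e.
  by apply: cvgZr_tmp; exact: Complex_continuous.
have Hz : z + (q.1 +i* q.2)%C *: e @[q --> p] --> z + (p.1 +i* p.2)%C *: e.
  by apply: cvgD Hc; exact: cvg_cst.
exact: (cvg_pair (cvg_cst tau) Hz).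
Qed.

Lemma H1N_slice tau z j s t : 0 < Im tau -> H1N (slice tau z j s t).
Proof. by []. Qed.

Lemma alongU (f : jfun R N) tau z j s t h :
  along (CoordU j) f (slice tau z j s t) h = f (slice tau z j (s + h) t).
Proof.
rewrite /along /slice /= mulr0 addr0 -addrA -scalerDl; congr (f (_, _ + _ *: _)).
by apply/eqP; rewrite eq_complex /= addr0 !eqxx.
Qed.

Lemma alongV (f : jfun R N) tau z j s t h :
  along (CoordV j) f (slice tau z j s t) h = f (slice tau z j s (t + h)).
Proof.
rewrite /along /slice /= mulr0 addr0 scalerA -addrA -scalerDl.
congr (f (_, _ + _ *: _)).
by apply/eqP; rewrite eq_complex /= !(mulr0, mul0r, mulr1, subr0, addr0) !eqxx.
Qed.

Lemma rderivable_slice (f : jfun R N) tau z j s t :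
  (forall d, rderivable d f (slice tau z j s t)) ->
  let U := rpartial (CoordU j) f (slice tau z j s t) in
  let V := rpartial (CoordV j) f (slice tau z j s t) in
  [/\ is_derive s 1 (fun s => Re (f (slice tau z j s t))) (Re U),
      is_derive s 1 (fun s => Im (f (slice tau z j s t))) (Im U),
      is_derive t 1 (fun t => Re (f (slice tau z j s t))) (Re V)
    & is_derive t 1 (fun t => Im (f (slice tau z j s t))) (Im V)].
Proof.
move=> fd; have [u1 u2] := fd (CoordU j); have [v1 v2] := fd (CoordV j).
have eU : along (CoordU j) f (slice tau z j s t) = fun h => f (slice tau z j (s + h) t).
  by apply/funext => h; exact: alongU.
have eV : along (CoordV j) f (slice tau z j s t) = fun h => f (slice tau z j s (t + h)).
  by apply/funext => h; exact: alongV.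
rewrite /rpartial /= eU eV in u1 u2 v1 v2 *; split.
- exact: (@is_derive_translate R (fun s => Re (f (slice tau z j s t))) _ u1).
- exact: (@is_derive_translate R (fun s => Im (f (slice tau z j s t))) _ u2).
- exact: (@is_derive_translate R (fun t => Re (f (slice tau z j s t))) _ v1).
- exact: (@is_derive_translate R (fun t => Im (f (slice tau z j s t))) _ v2).
Qed.

Section Partials.
Variables (f : jfun R N) (tau : C) (z : 'cV[C]_N) (j : 'I_N).
Hypotheses (tau0 : 0 < Im tau) (fs : smooth f).
Local Notation sl := (slice tau z j).

Lemma slice_partials_Re w :
  partials (fun s t => Re (foldr (@rpartial R N) f w (sl s t)))
    (fun s t => Re (foldr (@rpartial R N) f (CoordU j :: w) (sl s t)))
    (fun s t => Re (foldr (@rpartial R N) f (CoordV j :: w) (sl s t))).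
Proof.
move=> s t; have [_ fd] := fs w (H1N_slice z j s t tau0).
by have [d1 _ d2 _] := rderivable_slice fd; exact: (conj d1 d2).
Qed.

Lemma slice_partials_Im w :
  partials (fun s t => Im (foldr (@rpartial R N) f w (sl s t)))
    (fun s t => Im (foldr (@rpartial R N) f (CoordU j :: w) (sl s t)))
    (fun s t => Im (foldr (@rpartial R N) f (CoordV j :: w) (sl s t))).
Proof.
move=> s t; have [_ fd] := fs w (H1N_slice z j s t tau0).
by have [_ d1 _ d2] := rderivable_slice fd; exact: (conj d1 d2).
Qed.

Lemma slice_continuous_Re w :
  continuous2 (fun s t => Re (foldr (@rpartial R N) f w (sl s t))).
Proof.
move=> p; have [fc _] := fs w (H1N_slice z j p.1 p.2 tau0).
have H := cvg_comp _ _ (@slice_continuous tau z j p) fc.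
exact: cvg_comp _ _ H (@Re_continuous _).
Qed.

Lemma slice_continuous_Im w :
  continuous2 (fun s t => Im (foldr (@rpartial R N) f w (sl s t))).
Proof.
move=> p; have [fc _] := fs w (H1N_slice z j p.1 p.2 tau0).
have H := cvg_comp _ _ (@slice_continuous tau z j p) fc.
exact: cvg_comp _ _ H (@Im_continuous _).
Qed.

End Partials.
End Slice.

(** * Lattice translations and the operators Y_+ and Y_- on a line *)

Section Application.
Variables (R : realType) (N : nat).
Local Notation C := R[i].
Local Notation Re := (@complex.Re R).
Local Notation Im := (@complex.Im R).
Variables (k : int) (L : 'M[R]_N) (phi : jfun R N).
Implicit Types (tau : C) (z : 'cV[C]_N) (j : 'I_N).

Hypothesis inv : forall A, jacobi_group A -> forall p, H1N p -> slash k L A phi p = phi p.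

(** The elements of the Jacobi group that act on z by lattice translations
    and fix tau. *)
Definition translation (X1 X2 : 'cV[int]_N) : 'M[int]_2 * 'M[int]_(N, 2) :=
  (1%:M, \matrix_(i, l) if l == 0 then X1 i 0 else X2 i 0).

Lemma slash_translation (X1 X2 : 'cV[int]_N) tau z : 0 < Im tau ->
  let X1' := map_mx (intr : int -> C) X1 in let X2' := map_mx (intr : int -> C) X2 in
  phi (tau, z) =
  cexp (2 * (pi : R)%:C%C * 'i%C *
    (2 * (X1'^T *m mxC L *m z) 0 0 + tau * qform (mxC L) X1'))
  * phi (tau, z + tau *: X1' + X2').
Proof.
move=> tau0 X1' X2'; rewrite -(inv (A := translation X1 X2) (det1 _ _) (p := (tau, z)) tau0).
rewrite /slash /translation /=.
have col0 : \col_i ((translation X1 X2).2 i 0)%:~R = X1' :> 'cV[C]_N.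
  by apply/matrixP => i l; rewrite !mxE /= ord1.
have col1 : \col_i ((translation X1 X2).2 i 1)%:~R = X2' :> 'cV[C]_N.
  by apply/matrixP => i l; rewrite !mxE /= ord1.
rewrite /= in col0 col1; rewrite {}col0 {}col1.
rewrite !mxE /= !mul0r !mul1r !add0r !addr0 oppr0 add0r.
have -> : 1%:~R = 1 :> C by [].
by rewrite exp1rz mul1r divr1 invr1 scale1r.
Qed.

Lemma slice_translation_real tau z j s t : 0 < Im tau ->
  phi (slice tau z j (s + 1) t) = phi (slice tau z j s t).
Proof.
move=> tau0; rewrite [RHS](slash_translation 0 (delta_mx j 0) _ tau0).
rewrite map_mx0 map_delta_mx /qform trmx0 !mul0mx !mxE !mulr0 addr0 mulr0.
rewrite scaler0 addr0 -addrA /cexp /= expR0 cos0 sin0 complexr0 !mul1r /slice.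
have -> : ((s + 1) +i* t)%C = (s +i* t)%C + 1.
  by apply/eqP; rewrite eq_complex /= addr0 !eqxx.
by rewrite scalerDl scale1r.
Qed.

(** The automorphy factor exp (2 pi i (2 (L Z)_j + tau L_jj)), Z being the
    point s + i t of the line through z, with modulus and argument separated. *)
Lemma slice_translation_tau tau z j s t : 0 < Im tau ->
  let q := (mxC L *m z) j 0 in
  let m := 2 * pi * (2 * Im q + Im tau * L j j) in
  let n := 2 * pi * (2 * Re q + Re tau * L j j) in
  let e := expR (- (4 * pi * L j j * t + m)) in
  let th := 4 * pi * L j j * s + n in
  phi (slice tau z j s t) =
  (e * cos th +i* (e * sin th))%C * phi (slice tau z j (s + Re tau) (t + Im tau)).
Proof.
move=> tau0 q m n e th; rewrite [LHS](slash_translation (delta_mx j 0) 0 _ tau0).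
rewrite map_mx0 map_delta_mx addr0; congr (_ * phi (_, _)); last first.
  rewrite -addrA -scalerDl; congr (_ + _ *: _).
  by case: (tau).
have -> : qform (mxC L) (delta_mx j 0) = (L j j)%:C%C.
  by rewrite /qform trmx_delta -rowE -colE !mxE.
have -> : ((delta_mx j 0 : 'cV[C]_N)^T *m mxC L *m (z + (s +i* t)%C *: delta_mx j 0)) 0 0
    = q + (s +i* t)%C * (L j j)%:C%C :> C.
  rewrite trmx_delta -mulmxA -rowE mxE mulmxDr mxE; congr (_ + _).
  by rewrite -scalemxAr mxE -colE !mxE.
rewrite /cexp; set W := _ * (_ + _).
have -> : Re W = - (4 * pi * L j j * t + m).
  rewrite /W /m; case: (q) (tau) => a b [c d] /=; ring.
have -> : Im W = th.
  rewrite /W /th /n; case: (q) (tau) => a b [c d] /=; ring.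
by rewrite -/e; apply/eqP; rewrite eq_complex /= !mul0r subr0 addr0 !eqxx.
Qed.

Section Dbar.
Hypothesis phis : smooth phi.
Local Notation D w p := (foldr (@rpartial R N) phi w p).

(** Real and imaginary parts of the slice of D (2 d_zbar_j phi), D being the
    composite of the partial derivatives in w.  Twice d_zbar_j keeps
    denominators out, and letting w vary supplies all derivatives that the
    maximum principle needs. *)
Definition dbarRe (w : seq (real_coord N)) tau z j s t : R :=
  Re (D (w ++ [:: CoordU j]) (slice tau z j s t))
  - Im (D (w ++ [:: CoordV j]) (slice tau z j s t)).
Definition dbarIm (w : seq (real_coord N)) tau z j s t : R :=
  Im (D (w ++ [:: CoordU j]) (slice tau z j s t))
  + Re (D (w ++ [:: CoordV j]) (slice tau z j s t)).

Lemma dbarRe_partials w tau z j : 0 < Im tau ->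
  partials (dbarRe w tau z j) (dbarRe (CoordU j :: w) tau z j)
           (dbarRe (CoordV j :: w) tau z j).
Proof.
move=> tau0 s t.
have [a1 a2] := slice_partials_Re z j tau0 phis (w ++ [:: CoordU j]) s t.
have [b1 b2] := slice_partials_Im z j tau0 phis (w ++ [:: CoordV j]) s t.
by split; [exact: is_derive_sub a1 b1|exact: is_derive_sub a2 b2].
Qed.

Lemma dbarIm_partials w tau z j : 0 < Im tau ->
  partials (dbarIm w tau z j) (dbarIm (CoordU j :: w) tau z j)
           (dbarIm (CoordV j :: w) tau z j).
Proof.
move=> tau0 s t.
have [a1 a2] := slice_partials_Im z j tau0 phis (w ++ [:: CoordU j]) s t.
have [b1 b2] := slice_partials_Re z j tau0 phis (w ++ [:: CoordV j]) s t.
by split; [exact: is_derive_add a1 b1|exact: is_derive_add a2 b2].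
Qed.

Lemma dbarRe_continuous w tau z j : 0 < Im tau -> continuous2 (dbarRe w tau z j).
Proof.
move=> tau0 p; apply: cvgB.
  exact: slice_continuous_Re tau0 phis _ p.
exact: slice_continuous_Im tau0 phis _ p.
Qed.

Lemma dbarIm_continuous w tau z j : 0 < Im tau -> continuous2 (dbarIm w tau z j).
Proof.
move=> tau0 p; apply: cvgD.
  exact: slice_continuous_Im tau0 phis _ p.
exact: slice_continuous_Re tau0 phis _ p.
Qed.

Lemma dzb_slice tau z j s t : dzb j phi (slice tau z j s t) =
  (dbarRe [::] tau z j s t / 2 +i* (dbarIm [::] tau z j s t / 2))%C.
Proof.
pose U := rpartial (CoordU j) phi (slice tau z j s t).
pose V := rpartial (CoordV j) phi (slice tau z j s t).
rewrite -[dbarRe _ _ _ _ _ _]/(Re U - Im V) -[dbarIm _ _ _ _ _ _]/(Im U + Re V).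
rewrite /dzb -/U -/V; case: U V => [a b] [c d].
have -> : 2^-1 = (2^-1)%:C%C :> C by rewrite fmorphV rmorph_nat.
by apply/eqP; rewrite eq_complex /=; apply/andP; split; apply/eqP; ring.
Qed.

Lemma Im_mxC_mul z j : Im ((mxC L *m z) j 0) =
  \sum_l L j l * Im (z l 0).
Proof.
rewrite mxE raddf_sum /=; apply: eq_bigr => l _.
by rewrite mxE Im_mul /= mul0r addr0.
Qed.

Lemma calL_mul z j :
  (calL L *m \col_l (Im (z l 0))%:C%C) j 0 =
  (0 +i* (2 * pi * Im ((mxC L *m z) j 0)))%C.
Proof.
rewrite Im_mxC_mul /calL -scalemxAl mxE mxE.
under eq_bigr do rewrite mxE mxE -rmorphM.
rewrite -rmorph_sum /=; move: (\sum_i _) => S.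
by apply/eqP; rewrite eq_complex /=; apply/andP; split; apply/eqP; ring.
Qed.

(** The factor c anticipates [harmonic_diag], where Y_+,j acts on a multiple of
    Y_-,j phi: with explicit derivatives it simply comes out. *)
Lemma Yplus_Yminus_slice (c : R) tau z j s t : 0 < Im tau ->
  let y := Im tau in
  let l := 2 * pi * Im ((mxC L *m (slice tau z j s t).2) j 0) in
  Yplus L j (fun p => c%:C%C * Yminus j phi p) (slice tau z j s t) =
  c%:C%C *
  ((y / 4 * (dbarRe [:: CoordU j] tau z j s t + dbarIm [:: CoordV j] tau z j s t)
      - l * dbarIm [::] tau z j s t)
   +i* (y / 4 * (dbarIm [:: CoordU j] tau z j s t - dbarRe [:: CoordV j] tau z j s t)
      + l * dbarRe [::] tau z j s t))%C.
Proof.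
move=> tau0 y l.
pose g := fun p => c%:C%C * Yminus j phi p.
have gE a b : g (slice tau z j a b) =
   (c * y / 2 * dbarIm [::] tau z j a b +i* (- (c * y / 2) * dbarRe [::] tau z j a b))%C.
  rewrite /g /Yminus dzb_slice -/y.
  by apply/eqP; rewrite eq_complex /=; apply/andP; split; apply/eqP; ring.
have [u1 u2] := dbarIm_partials [::] z j tau0 s t.
have [v1 v2] := dbarRe_partials [::] z j tau0 s t.
have gU : rpartial (CoordU j) g (slice tau z j s t) =
   (c * y / 2 * dbarIm [:: CoordU j] tau z j s t
    +i* (- (c * y / 2) * dbarRe [:: CoordU j] tau z j s t))%C.
  rewrite /rpartial; congr (_ +i* _)%C.
    under eq_fun do rewrite alongU gE /=.
    exact: (@derive1_translateE R (fun a => c * y / 2 * dbarIm [::] tau z j a t) _ _ (is_deriveZ (c * y / 2) u1)).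
  under eq_fun do rewrite alongU gE /=.
  exact: (@derive1_translateE R (fun a => - (c * y / 2) * dbarRe [::] tau z j a t) _ _ (is_deriveZ (- (c * y / 2)) v1)).
have gV : rpartial (CoordV j) g (slice tau z j s t) =
   (c * y / 2 * dbarIm [:: CoordV j] tau z j s t
    +i* (- (c * y / 2) * dbarRe [:: CoordV j] tau z j s t))%C.
  rewrite /rpartial; congr (_ +i* _)%C.
    under eq_fun do rewrite alongV gE /=.
    exact: (@derive1_translateE R (fun a => c * y / 2 * dbarIm [::] tau z j s a) _ _ (is_deriveZ (c * y / 2) u2)).
  under eq_fun do rewrite alongV gE /=.
  exact: (@derive1_translateE R (fun a => - (c * y / 2) * dbarRe [::] tau z j s a) _ _ (is_deriveZ (- (c * y / 2)) v2)).
rewrite /Yplus -/(g _) gE /dz gU gV -/y.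
rewrite calL_mul -/l.
have -> : 2^-1 = (2^-1)%:C%C :> C by rewrite fmorphV rmorph_nat.
have -> : (y%:C%C)^-1 = (y^-1)%:C%C :> C by rewrite fmorphV.
have y0 : y != 0 by rewrite gt_eqF.
clear gU gV gE u1 u2 v1 v2; clearbody y l.
move: (dbarRe [::] _ _ _ _ _) (dbarIm [::] _ _ _ _ _) => a b.
move: (dbarRe _ _ _ _ _ _) (dbarIm _ _ _ _ _ _) => as_ bt.
move: (dbarRe _ _ _ _ _ _) (dbarIm _ _ _ _ _ _) => at_ bs.
by apply/eqP; rewrite eq_complex /=; apply/andP; split; apply/eqP; field.
Qed.

End Dbar.
End Application.

(** * Vanishing of the antiholomorphic derivatives *)

Section Vanish.
Variables (R : realType) (N : nat).
Local Notation C := R[i].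
Local Notation Re := (@complex.Re R).
Local Notation Im := (@complex.Im R).
Variables (k : int) (L : 'M[R]_N) (phi : jfun R N).
Implicit Types (tau : C) (z : 'cV[C]_N) (j : 'I_N).
Hypothesis phis : smooth phi.

Lemma slice0 (p : hpoint R N) j : p = slice p.1 p.2 j 0 0.
Proof.
case: p => tau z; rewrite /slice /=.
have -> : (0 +i* 0)%C = 0 :> C by [].
by rewrite scale0r addr0.
Qed.

Lemma Yplus_Yminus_scale (c : R) j p : H1N p ->
  Yplus L j (fun p => c%:C%C * Yminus j phi p) p =
  c%:C%C * Yplus L j (Yminus j phi) p.
Proof.
move=> p0; rewrite (slice0 p j) Yplus_Yminus_slice //.
have E : Yminus j phi = fun p => 1%:C%C * Yminus j phi p.
  by apply/funext => q; rewrite mul1r.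
by rewrite [in RHS]E Yplus_Yminus_slice // mul1r.
Qed.

(** A diagonal B makes mxop B collapse to one term, which leaves a linear
    relation between the Y_+,i Y_-,i phi with coefficients d_i^2. *)
Lemma harmonic_diag (d : 'I_N -> R) p : H_harmonic L phi -> H1N p ->
  (forall i, d i != 0) ->
  \sum_i (d i ^+ 2)%:C%C * Yplus L i (Yminus i phi) p = 0.
Proof.
move=> harm p0 d0; pose B : 'M[R]_N := diag_mx (\row_i d i).
have B0 : B \in unitmx.
  rewrite unitmxE det_diag unitfE; apply/prodf_neq0 => i _.
  by rewrite mxE.
have BE (D : 'I_N -> jfun R N -> jfun R N) i f : mxop B D i f = fun p => (d i)%:C%C * D i f p.
  apply/funext => q; rewrite /mxop (bigD1 i) //= big1 => [|l li].
    by rewrite !mxE eqxx mulr1n addr0.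
  by rewrite !mxE eq_sym (negbTE li) mulr0n mul0r.
rewrite -[RHS](harm B B0 p p0); apply: eq_bigr => i _.
by rewrite BE BE Yplus_Yminus_scale // mulrA -rmorphM expr2.
Qed.

(** Compare B = 1 with the diagonal matrix that has 2 in position j and 1
    elsewhere: the two relations differ by 3 Y_+,j Y_-,j phi. *)
Lemma harmonic_component j p : H_harmonic L phi -> H1N p ->
  Yplus L j (Yminus j phi) p = 0.
Proof.
move=> harm p0.
have E1 := harmonic_diag (d := fun=> 1) harm p0 (fun _ => oner_neq0 _).
have E2 := harmonic_diag (d := fun i => if i == j then 2 else 1) harm p0.
have {}E2 := E2 (fun i => ltac:(by case: ifP; rewrite ?oner_neq0 // pnatr_eq0)).
move: E1 E2; rewrite (bigD1 j) //= [in X in _ -> X](bigD1 j) //= eqxx.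
under [in X in _ -> X]eq_bigr => i /negbTE-> do [].
move: (\sum_(i | _) _) (Yplus _ _ _ _) => S Q.
rewrite expr1n mul1r rmorphXn rmorph_nat => E1 E2.
have : 3 * Q = 0.
  by rewrite -[RHS](subrr 0) -{1}E2 -E1; ring.
by move=> /eqP; rewrite mulf_eq0 pnatr_eq0 /= => /eqP.
Qed.

Hypothesis inv : forall A, jacobi_group A -> forall p, H1N p -> slash k L A phi p = phi p.
Hypothesis harm : H_harmonic L phi.
Hypothesis Lpos : forall w : 'cV[R]_N, w != 0 -> 0 < qform L w.

Lemma index_diag_gt0 j : 0 < L j j.
Proof.
have -> : L j j = qform L (delta_mx j 0) by rewrite /qform trmx_delta -rowE -colE !mxE.
apply: Lpos; apply/negP => /eqP/matrixP/(_ j 0)/eqP.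
by rewrite !mxE !eqxx oner_eq0.
Qed.

Lemma Im_qslice tau z j s t :
  Im ((mxC L *m (slice tau z j s t).2) j 0) = Im ((mxC L *m z) j 0) + L j j * t.
Proof.
rewrite /= mulmxDr mxE Im_add; congr (_ + _).
by rewrite -scalemxAr mxE -colE !mxE Im_mul /= mulr0 add0r mulrC.
Qed.

(** The additive constant of 4 pi L[v] / y on the line is dropped from psi:
    it would only rescale h. *)
Lemma dbar_slice_eq0 tau z j s t : 0 < Im tau ->
  dbarRe phi [::] tau z j s t = 0 /\ dbarIm phi [::] tau z j s t = 0.
Proof.
move=> tau0; set y := Im tau; set l := L j j.
pose q := Im ((mxC L *m z) j 0).
pose psi t := 4 * pi / y * (l * t ^+ 2 + 2 * q * t).
pose dpsi t := 8 * pi / y * (l * t + q).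
have y0 : y != 0 by rewrite gt_eqF.
have l0 : 0 < l := index_diag_gt0 j.
have c0 : 0 < 8 * pi / y * l by rewrite !mulr_gt0 // ?pi_gt0 ?invr_gt0.
have dp (u : R) : is_derive u 1 psi (dpsi u).
  have H := is_deriveZ (4 * pi / y) (is_derive_add
    (is_deriveZ l (is_derive_mul (is_derive_id u 1) (is_derive_id u 1)))
    (is_deriveZ (2 * q) (is_derive_id u 1))).
  apply: is_derive_eq H _; rewrite /dpsi -![_ *: _]/(_ * _); ring.
have ddp (u : R) : is_derive u 1 dpsi (8 * pi / y * l).
  have H := is_deriveZ (8 * pi / y) (is_derive_add
    (is_deriveZ l (is_derive_id u 1)) (is_derive_cst q u 1)).
  by apply: is_derive_eq H _; rewrite -![_ *: _]/(_ * _); ring.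
have eqs a b := Yplus_Yminus_slice L phis 1 z j a b tau0.
have {}eqs a b :
  dbarRe phi [:: CoordU j] tau z j a b =
    dpsi b * dbarIm phi [::] tau z j a b - dbarIm phi [:: CoordV j] tau z j a b /\
  dbarIm phi [:: CoordU j] tau z j a b =
    dbarRe phi [:: CoordV j] tau z j a b - dpsi b * dbarRe phi [::] tau z j a b.
  have := eqs a b; cbv zeta; rewrite Yplus_Yminus_scale // harmonic_component // mulr0 rmorph1 mul1r.
  rewrite Im_qslice -/q -/l -/y => /esym[E1 E2].
  rewrite /dpsi; split; apply: (mulfI (_ : y / 4 != 0)) ; rewrite ?mulf_neq0 ?invr_eq0 ?pnatr_eq0 //.
    rewrite -[RHS]addr0 -[X in _ + X]E1; field.
    exact: y0.
  rewrite -[RHS]addr0 -[X in _ + X]E2; field.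
  exact: y0.
have PR w := dbarRe_partials phis w z j tau0.
have PI w := dbarIm_partials phis w z j tau0.
have CR w : continuous2 (dbarRe phi w tau z j) by exact: dbarRe_continuous.
have CI w : continuous2 (dbarIm phi w tau z j) by exact: dbarIm_continuous.
have pF1 : partials (fun a b => Re (phi (slice tau z j a b))) _ _ :=
  slice_partials_Re z j tau0 phis [::].
have pF2 : partials (fun a b => Im (phi (slice tau z j a b))) _ _ :=
  slice_partials_Im z j tau0 phis [::].
apply: (torus_twisted_vanish (x := Re tau) tau0 c0 dp ddp (CR _) (CI _)
  (PR _) (PR _) (PR _) (CR _) (CR _) (PI _) (PI _) (PI _) (CI _) (CI _)
  (fun a b => (eqs a b).1) (fun a b => (eqs a b).2)) => a b.
  have cst0 (c : R) : partials (fun _ _ : R => c) (fun _ _ => 0) (fun _ _ => 0).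
    by move=> ? ?; split; exact: is_derive_cst.
  have [] := dbar_factor (partials_translate 1 0 pF1) (partials_translate 1 0 pF2) pF1 pF2
    (E1 := fun _ _ => 1) (E1s := fun _ _ => 0) (E1t := fun _ _ => 0) (E2 := fun _ _ => 0)
    _ _ _ _ a b.
  - exact: cst0.
  - by move=> u v; rewrite oppr0; exact: cst0.
  - by move=> u v; rewrite (slice_translation_real inv) // addr0 mul1r mul0r subr0.
  - by move=> u v; rewrite (slice_translation_real inv) // addr0 mul1r mul0r addr0.
  rewrite addr0 !mul1r !mul0r subr0 addr0 => E1 E2.
  have -> : dbarRe phi [::] tau z j (a + 1) b = dbarRe phi [::] tau z j a b := E1.
  by have -> : dbarIm phi [::] tau z j (a + 1) b = dbarIm phi [::] tau z j a b := E2.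
set m := 2 * pi * (2 * Im ((mxC L *m z) j 0) + Im tau * L j j).
set n := 2 * pi * (2 * Re ((mxC L *m z) j 0) + Re tau * L j j).
have [pE1 pE2] := exp_partials (4 * pi * L j j) m n.
have [] := dbar_factor pF1 pF2 (partials_translate (Re tau) (Im tau) pF1)
  (partials_translate (Re tau) (Im tau) pF2) pE1 pE2 _ _ a b.
- by move=> u v; rewrite (slice_translation_tau inv) // Re_mul.
- by move=> u v; rewrite (slice_translation_tau inv) // Im_mul.
set e := expR (- (4 * pi * L j j * b + m)); set th := 4 * pi * L j j * a + n.
set A' := dbarRe phi [::] tau z j (a + Re tau) (b + Im tau).
set B' := dbarIm phi [::] tau z j (a + Re tau) (b + Im tau).
move=> E1 E2.
have -> : dbarRe phi [::] tau z j a b = e * cos th * A' - e * sin th * B' := E1.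
have -> : dbarIm phi [::] tau z j a b = e * cos th * B' + e * sin th * A' := E2.
(* The weight compensates the squared modulus of the automorphy factor. *)
have -> : expR (- psi (b + y)) = e * e * expR (- psi b).
  rewrite /e -!expRD; congr expR; rewrite /psi /m -/y -/q -/l; field.
  exact: y0.
have := cos2Dsin2 th; move: (cos th) (sin th) (expR _) => c' s' w cs.
have -> : (e * c' * A' - e * s' * B') ^+ 2 + (e * c' * B' + e * s' * A') ^+ 2 =
  (c' ^+ 2 + s' ^+ 2) * (e * e) * (A' ^+ 2 + B' ^+ 2) by ring.
by rewrite cs mul1r; ring.
Qed.

End Vanish.

(** * Complex differentiability *)

Section Holomorphic.
Variables (R : realType) (N : nat).
Local Notation C := R[i].
Local Notation Re := (@complex.Re R).
Local Notation Im := (@complex.Im R).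
Variables (phi : jfun R N) (tau : C).
Implicit Types (z w h : 'cV[C]_N) (j : 'I_N).
Hypotheses (phis : smooth phi) (tau0 : 0 < Im tau).
Hypothesis CR : forall j w,
  rpartial (CoordV j) phi (tau, w) = 'i%C * rpartial (CoordU j) phi (tau, w).

Local Notation g := (fun w : 'cV[C]_N => phi (tau, w)).
Local Notation D j w := (rpartial (CoordU j) phi (tau, w)).

Lemma norm_lincomb2_le (a b x y x' y' e : R) : `|x| <= e -> `|y| <= e -> `|x'| <= e -> `|y'| <= e ->
  `|a * x + b * y| + `|a * x' + b * y'| <= 2 * (`|a| + `|b|) * e.
Proof.
move=> hx hy hx' hy'.
have H u v : `|u| <= e -> `|v| <= e -> `|a * u + b * v| <= (`|a| + `|b|) * e.
  move=> hu hv; rewrite (le_trans (ler_normD _ _))// mulrDl !normrM.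
  by rewrite lerD // ler_wpM2l.
by rewrite -mulrA mulr_natl mulr2n lerD // H.
Qed.

(** The increment along s + i t is split into a real step and an imaginary
    step; the Cauchy-Riemann equation turns both into multiples of the same
    complex derivative. *)
Lemma coord_step j w (zeta c : C) (e : R) :
  (forall s t : R, `|s| <= `|Re zeta| -> `|t| <= `|Im zeta| ->
     `|D j (w + (s +i* t)%C *: delta_mx j 0) - c| <= e%:C%C) ->
  `|g (w + zeta *: delta_mx j 0) - g w - zeta * c| <= (4 * e)%:C%C * `|zeta|.
Proof.
case: zeta => a b /= H.
pose F s t := phi (slice tau w j s t).
pose d s t := D j (w + (s +i* t)%C *: delta_mx j 0).
have F0 : g w = F 0 0 by rewrite /= {1}[(tau, w)](slice0 _ j).
have Fab : g (w + (a +i* b)%C *: delta_mx j 0) = F a b by [].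
have dE s t : rpartial (CoordU j) phi (slice tau w j s t) = d s t by [].
have dE' s t : rpartial (CoordV j) phi (slice tau w j s t) = 'i%C * d s t.
  exact: CR.
rewrite F0 {}Fab.
have {}H s t : `|s| <= `|a| -> `|t| <= `|b| -> `|d s t - c| <= e%:C%C by exact: H.
have PR (s t : R) : is_derive s 1 (fun s => Re (F s t)) (Re (d s t)) /\
    is_derive t 1 (fun t => Re (F s t)) (Re ('i%C * d s t)).
  by rewrite -dE'; exact: (slice_partials_Re w j tau0 phis [::] s t).
have PI (s t : R) : is_derive s 1 (fun s => Im (F s t)) (Im (d s t)) /\
    is_derive t 1 (fun t => Im (F s t)) (Im ('i%C * d s t)).
  by rewrite -dE'; exact: (slice_partials_Im w j tau0 phis [::] s t).
clearbody F d; clear F0 dE dE'.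
have [s1 s1a E1] := MVT_dist 0 a (fun s => (PR s 0).1).
have [t1 t1b E2] := MVT_dist 0 b (fun t => (PR a t).2).
have [s2 s2a E3] := MVT_dist 0 a (fun s => (PI s 0).1).
have [t2 t2b E4] := MVT_dist 0 b (fun t => (PI a t).2).
rewrite !subr0 in s1a t1b s2a t2b E1 E2 E3 E4.
rewrite Re_mul Im_mul /= !(mul0r, mul1r, sub0r, add0r) in E2 E4.
have n0 : `|0 : R| <= `|b| by rewrite normr0.
have H1 := H s1 0 s1a n0; have H2 := H a t1 (lexx _) t1b.
have H3 := H s2 0 s2a n0; have H4 := H a t2 (lexx _) t2b.
have bRe (x : C) : `|x| <= e%:C%C -> `|Re x| <= e.
  by move=> xe; rewrite -lecR; exact: le_trans (normc_Re_le x) xe.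
have bIm (x : C) : `|x| <= e%:C%C -> `|Im x| <= e.
  by move=> xe; rewrite -lecR; exact: le_trans (normc_Im_le x) xe.
set err := _ - _ - _.
have eRe : Re err = a * Re (d s1 0 - c) + b * (- Im (d a t1 - c)).
  by rewrite /err !raddfB /= Re_mul /=; lra.
have eIm : Im err = a * Im (d s2 0 - c) + b * Re (d a t2 - c).
  by rewrite /err !raddfB /= Im_mul /=; lra.
have e0 : 0 <= e by rewrite -(ler0c e) (le_trans _ H1).
apply: le_trans (normc_le_ReIm _) _; rewrite eRe eIm.
have ab : (`|a| + `|b|)%:C%C <= 2 * `|(a +i* b)%C|.
  rewrite rmorphD mulr_natl mulr2n lerD //.
    exact: (normc_Re_le (a +i* b)%C).
  exact: (normc_Im_le (a +i* b)%C).
apply: le_trans (_ : (2 * (`|a| + `|b|) * e)%:C%C <= _).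
  by rewrite lecR; apply: norm_lincomb2_le; rewrite ?normrN; auto.
have -> : 2 * (`|a| + `|b|) * e = 2 * e * (`|a| + `|b|) by ring.
rewrite rmorphM (_ : 4 * e = 2 * e * 2); last by ring.
rewrite [in leRHS]rmorphM -mulrA (rmorph_nat _ 2) ler_wpM2l // ler0c.
by rewrite mulr_ge0.
Qed.

End Holomorphic.

Section Frechet.
Variables (R : realType) (N : nat).
Local Notation C := R[i].
Local Notation Re := (@complex.Re R).
Local Notation Im := (@complex.Im R).

Lemma col_norm_ge (h : 'cV[C]_N) j : `|h j 0| <= `|h|.
Proof.
rewrite -[`|h|]/(mx_norm h) mx_normE -[leLHS]nngE num_le.
exact: (le_bigmax _ (fun i => `|h i.1 i.2|%:nng) (j, 0)).
Qed.

Definition lin_form (d : 'I_N -> C) (h : 'cV[C]_N) : C := \sum_j h j 0 * d j.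

Lemma lin_form_is_linear d : linear (lin_form d).
Proof.
move=> a u v; rewrite /lin_form scaler_sumr -big_split /=.
by apply: eq_bigr => j _; rewrite !mxE mulrDl -mulrA.
Qed.

HB.instance Definition _ d :=
  GRing.isLinear.Build C 'cV[C]_N C _ (lin_form d) (lin_form_is_linear d).

Lemma lin_form_continuous d : continuous (lin_form d).
Proof.
apply: (@continuous_big C 'I_N +%R 0 predT (@add_continuous C) 'cV[C]_N
  (index_enum 'I_N) (fun j h => h j 0 * d j)).
move=> j _ h; have H : {for h, continuous (fun h : 'cV[C]_N => h j 0)}.
  exact: coord_continuous.
exact: (cvgM H (cvg_cst (d j))).
Qed.

Variables (phi : jfun R N) (tau : C).
Implicit Types (z w h : 'cV[C]_N) (j : 'I_N).
Hypotheses (phis : smooth phi) (tau0 : 0 < Im tau).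
Hypothesis CR : forall j w,
  rpartial (CoordV j) phi (tau, w) = 'i%C * rpartial (CoordU j) phi (tau, w).

Local Notation g := (fun w : 'cV[C]_N => phi (tau, w)).
Local Notation D j w := (rpartial (CoordU j) phi (tau, w)).

(** Interpolates coordinate by coordinate between 0 and h. *)
Definition upto (h : 'cV[C]_N) (m : nat) : 'cV[C]_N :=
  \col_i (if (i < m)%N then h i 0 else 0).

Lemma uptoS h j : upto h j.+1 = upto h j + h j 0 *: delta_mx j 0.
Proof.
apply/matrixP => i k; rewrite !mxE ord1 eqxx andbT ltnS.
case: (ltngtP i j) => ij.
- by rewrite -val_eqE /= (ltn_eqF ij) mulr0 addr0.
- by rewrite -val_eqE /= (gtn_eqF ij) mulr0 addr0.
- by rewrite (val_inj ij) eqxx mulr1 add0r.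
Qed.

Lemma partial_continuous j z : {for z, continuous (fun w => D j w : C)}.
Proof.
have [fc _] := phis [:: CoordU j] (tau0 : H1N (tau, z)).
have H : (tau, w) @[w --> z] --> (tau, z) :=
  @cvg_pair _ _ _ (nbhs z) (nbhs tau) (nbhs z) (nbhs_filter z) (nbhs_filter tau)
    (nbhs_filter z) (cst tau) id (cvg_cst tau) (fun _ p => p).
have K := cvg_comp _ _ (H (nbhs_filter z)) fc.
exact: K.
Qed.

(** All points met on the way from z to z + h differ from z by at most
    2 |h| in each coordinate, whence the bound r / 2 on |h|. *)
Lemma increment_le z h (e : R) (r : C) : 0 < r -> `|h| < r / 2 ->
  (forall w, ball z r w -> forall j, `|D j w - D j z| <= e%:C%C) ->
  `|g (z + h) - g z - lin_form (fun j => D j z) h| <= (4 * e)%:C%C * `|h| *+ N.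
Proof.
move=> r0 hr H.
have e0 : forall j : 'I_N, 0 <= e.
  move=> j; rewrite -(ler0c e) (le_trans _ (H z (ballxx z r0) j))//.
have -> : g (z + h) - g z = \sum_(j < N) (g (z + upto h j.+1) - g (z + upto h j)).
  rewrite -(big_mkord predT (fun m => g (z + upto h m.+1) - g (z + upto h m))).
  rewrite telescope_sumr //; congr (phi (_, _ + _) - phi (_, _)).
    by apply/matrixP => i k; rewrite mxE ord1 ltn_ord.
  by apply/matrixP => i k; rewrite !mxE ord1 ltn0 addr0.
rewrite /lin_form -sumrB; apply: le_trans (ler_norm_sum _ _ _) _.
rewrite -[X in _ *+ X](card_ord N) -sumr_const.
apply: ler_sum => j _; rewrite uptoS addrA.
apply: le_trans (_ : (4 * e)%:C%C * `|h j 0| <= _); last first.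
  by rewrite ler_wpM2l ?col_norm_ge // ler0c mulr_ge0 // (e0 j).
apply: coord_step => // s t sa tb; apply: H.
split=> // i k; rewrite ord1 -ball_normE /= !mxE eqxx andbT.
rewrite -addrA opprD addNKr normrN.
have hr2 : 2 * `|h| < r by rewrite mulrC -ltr_pdivlMr.
apply: le_lt_trans hr2; rewrite -val_eqE /=.
have h2 : `|h| <= 2 * `|h| by rewrite mulr_natl mulr2n lerDl.
case: (ltngtP i j) => ij.
- by rewrite mulr0 addr0 (le_trans (col_norm_ge _ _)).
- by rewrite mulr0 addr0 normr0 mulr_ge0.
- rewrite add0r mulr1 (le_trans (normc_le_ReIm _)) //= rmorphD mulr_natl mulr2n.
  apply: lerD; apply: le_trans (col_norm_ge h j).
    by apply: le_trans (normc_Re_le _); rewrite lecR.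
  by apply: le_trans (normc_Im_le _); rewrite lecR.
Qed.

Lemma differentiable_of_CR z : differentiable (g : 'cV[C]_N -> C) z.
Proof.
pose df : {linear 'cV[C]_N -> C} := lin_form (fun j => D j z).
have dfc : continuous df by exact: lin_form_continuous.
pose V : normedModType C := 'cV[C]_N; pose W : normedModType C := C.
have E : (g : V -> W) \o shift (z : V) = cst (g z : W) + (df : V -> W) +o_ (0 : V) id.
  apply/eqaddoP => eps eps0.
  have [epsr epsI] : 0 < Re eps /\ Im eps = 0.
    by move: eps0; rewrite ltcE /= => /andP[/eqP-> ->].
  (* [increment_le] loses a factor 4 N; N.+1 avoids a case distinction at N = 0. *)
  pose e := Re eps / (4 * N.+1%:R).
  have e0 : 0 < e by rewrite divr_gt0.
  have : \forall w \near nbhs z, forall j, `|D j w - D j z| < e%:C%C.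
    apply: filter_forall => j.
    have ec : 0 < e%:C%C :> C by rewrite ltcR.
    have K := @partial_continuous j z.
    exact: (@cvgr_distC_lt C C _ (nbhs z) _ (fun w => D j w : C) (D j z) K _ ec).
  move=> /nbhs_ballP[r /= r0 H].
  apply/nbhs_ballP; exists (r / 2); first by rewrite /= divr_gt0.
  move=> h; rewrite -ball_normE /= sub0r normrN => hr.
  have := increment_le r0 hr (fun w wr j => ltW (H w wr j)).
  rewrite -addrA -opprD [z + h]addrC; move/le_trans; apply.
  rewrite (_ : eps = (Re eps)%:C%C); last first.
    by rewrite [eps in LHS]complexE epsI mulr0 addr0.
  rewrite -mulrnAl -rmorphMn /= ler_wpM2r // lecR -mulr_natr /e.
  rewrite (_ : 4 * _ * _ = Re eps * (N%:R / N.+1%:R)); last by field.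
  by rewrite ler_piMr ?(ltW epsr) // ler_pdivrMr ?ltr0Sn // mul1r ler_nat.
have dE := diff_unique dfc E.
by apply/diff_locallyP; rewrite dE.
Qed.

End Frechet.

Theorem theorem3p4 (R : realType) (N : nat) (hN : (2 <= N)%N) (k : int)
    (L : 'M[R]_N) (hL : is_index L) (phi : jfun R N)
    (hphi : maass_jacobi k L phi) (hharm : H_harmonic L phi) :
  holomorphic_in_z phi.
Proof.
have [phis inv _ _] := hphi; have [_ Lpos _ _] := hL.
move=> tau tau0 z; apply: differentiable_of_CR => // j w.
have [hRe hIm] := dbar_slice_eq0 phis inv hharm Lpos w j 0 0 tau0.
rewrite (slice0 (tau, w) j).
pose U := rpartial (CoordU j) phi (slice tau w j 0 0).
pose V := rpartial (CoordV j) phi (slice tau w j 0 0).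
have {}hRe : complex.Re U - complex.Im V = 0 := hRe.
have {}hIm : complex.Im U + complex.Re V = 0 := hIm.
rewrite -/U -/V; clearbody U V; case: U V hRe hIm => [a b] [c d] /= hRe hIm.
by apply/eqP; rewrite eq_complex /=; apply/andP; split; apply/eqP; lra.
Qed.
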